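(* Fix a (finite) Kuhn decision tree with perfect recall. Then no type of signal improves the team's performance: for signals that are classical (whether perfectly correlated, i.i.d., or exchangeable within information sets) or quantum, and that are independent of Nature, the highest expected payoff the team can achieve with the signals is no higher than the highest expected payoff it can achieve without signals.
   Context: Kuhn decision tree: a finite rooted tree whose non-terminal nodes are partitioned into decision nodes (of the decision maker (DM), i.e. the team) and chance nodes (of Nature). Decision nodes are partitioned into information sets $I$, and chance nodes into information sets $J$, such that (i) all nodes in the same information set have the same number of outgoing branches, with a given 1-1 correspondence between the outgoing branches of different nodes of the set (so each $I$ has a well-defined set $M_I$ of moves, and likewise each $J$); (ii) every path from the root to a terminal node crosses each information set at most once. Terminal nodes carry real payoffs. A state $\psi$ selects a choice of Nature at each information set $J$; a probability measure on the finite set of states is given. Strategies without signals: a strategy $s$ selects a move in $M_I$ at each information set $I$ of the DM. A pair $(s,\psi)$ induces a unique path through the tree. The expected payoff of $s$ is the average over Nature's states of the payoff at the end of the induced path. Perfect recall: a decision node $n$ is allowed under $s$ if there is a state $\psi$ such that the path induced by $(s,\psi)$ passes through $n$. The DM has perfect recall if for every strategy $s$, information set $I$, and nodes $n,n^*\in I$, node $n$ is allowed under $s$ if and only if $n^*$ is allowed under $s$. Signals: each information set $I$ of the team has a finite non-empty signal set $\Omega_I$. When a node of $I$ is reached, a payoff-irrelevant signal in $\Omega_I$ is observed before moving. There may be one signal per information set, or a distinct signal, with values in $\Omega_I$, at each node of $I$. A path from the root to a terminal node crosses certain information sets of the team in a certain order; the sequences obtained in this way are those that arise in the tree. A signal structure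 associates to each sequence $I_{i_1}\cdots I_{i_K}$ that arises a probability measure $\mathrm{Pr}_{I_{i_1}\cdots I_{i_K}}$ on $\Omega_{I_{i_1}}\times\cdots\times\Omega_{I_{i_K}}$, the joint law of the signals observed along any path crossing this sequence (it depends only on the sequence of information sets, not on which of their nodes are crossed). Classical signals: with one signal per information set, there is a probability measure $\mu$ on $\prod_I\Omega_I$ such that each $\mathrm{Pr}_{I_{i_1}\cdots I_{i_K}}$ is the marginal of $\mu$ on $\Omega_{I_{i_1}}\times\cdots\times\Omega_{I_{i_K}}$. With a distinct signal at each node, all the signals are random variables on one joint probability space, and the signals at the different nodes of the same information set are perfectly correlated (equal), or i.i.d., or, more generally, exchangeable (their joint distribution is invariant under permutation); the measures $\mathrm{Pr}_{I_{i_1}\cdots I_{i_K}}$ are the resulting joint laws along paths. Quantum signals: the signal at each information set is the outcome of a measurement, specified for that information set, on a quantum system prepared in a fixed, possibly entangled, state (for example, several particles measured at different places); $\mathrm{Pr}_{I_{i_1}\cdots I_{i_K}}$ gives the quantum-mechanical probabilities of the joint outcomes of the measurements at $I_{i_1},\dots,I_{i_K}$. There need not be a joint probability measure on $\prod_I\Omega_I$ having all these measures as marginals. By the no-signaling property of quantum mechanics, such structures satisfy indistinguishability: for any two sequences of information sets that arise, the marginals of the two associated measures with respect to common subsequences agree. Strategies with signals: a strategy profile is a tuple of maps $f_I:\Omega_I\to M_I$, one for each information set $I$ of the team, giving the move made as a function of the signal observed there. Signals are independent of Nature. The expected payoff is the average of the terminal payoff over Nature and over the signals: a terminal node whose path crosses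 $I_{i_1},\dots,I_{i_K}$ with moves $m_1,\dots,m_K$ is reached with probability equal to the product of the probability that Nature's choices agree with the path and $\mathrm{Pr}_{I_{i_1}\cdots I_{i_K}}(\{(\omega_1,\dots,\omega_K): f_{I_{i_k}}(\omega_k)=m_k \text{ for all } k\})$.
   Formalization: For distinct signals at nodes, i.i.d. and exchangeable are taken to require that the joint law of all signals be invariant under permuting nodes within each information set; with i.i.d. or exchangeability only inside each set and arbitrary dependence across sets, the claim is false. *)

(* Defs.v *)
From HB Require Import structures.
From mathcomp Require Import all_boot all_order perm all_algebra.
From mathcomp Require Import all_classical all_reals.
From mathcomp Require Export complex.

Set Implicit Arguments.
Unset Strict Implicit.
Unset Printing Implicit Defensive.

Import Order.TTheory GRing.Theory Num.Theory.
Local Open Scope classical_set_scope.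
Local Open Scope ring_scope.

Definition is_prob (R : realType) (T : finType) (p : T -> R) : Prop :=
  (forall x, 0 <= p x) /\ \sum_x p x = 1.

(* [A] indexes the information sets of the DM and [B] those of Nature. All the
   nodes of an information set have the same type of moves ([M I], resp.
   [C J]), which encodes the given 1-1 correspondence between their outgoing
   branches. *)
Inductive tree (R : realType) (A B : finType)
    (M : A -> finType) (C : B -> finType) : Type :=
| Terminal (u : R)
| Decision (I : A) (next : M I -> tree R M C)
| Chance (J : B) (next : C J -> tree R M C).

Section Tree.
Variables (R : realType) (A B : finType) (M : A -> finType) (C : B -> finType).
Implicit Types (t : tree R M C) (I : A) (J : B).

Definition step : finType := ({I : A & M I} + {J : B & C J})%type.

(* A node is identified with the sequence of branches leading to it from the
   root; the root is [::]. *)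
Definition history := seq step.

Definition dstep I (m : M I) : step := inl (Tagged (fun I => M I) m).
Definition cstep J (c : C J) : step := inr (Tagged (fun J => C J) c).

Fixpoint nodes_in I t : seq history :=
  match t with
  | Terminal _ => [::]
  | Decision i next =>
      (if i == I then [:: [::]] else [::]) ++
      flatten [seq [seq dstep m :: h | h <- nodes_in I (next m)]
              | m <- enum (M i)]
  | Chance J next =>
      flatten [seq [seq cstep c :: h | h <- nodes_in I (next c)]
              | c <- enum (C J)]
  end.

Fixpoint terminals t : seq (history * R) :=
  match t with
  | Terminal u => [:: ([::], u)]
  | Decision i next =>
      flatten [seq [seq (dstep m :: z.1, z.2) | z <- terminals (next m)]
              | m <- enum (M i)]
  | Chance J next =>
      flatten [seq [seq (cstep c :: z.1, z.2) | z <- terminals (next c)]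
              | c <- enum (C J)]
  end.

Fixpoint crossed (h : history) : seq A :=
  match h with
  | [::] => [::]
  | inl x :: h' => tag x :: crossed h'
  | inr _ :: h' => crossed h'
  end.

Fixpoint crossed_nature (h : history) : seq B :=
  match h with
  | [::] => [::]
  | inl _ :: h' => crossed_nature h'
  | inr y :: h' => tag y :: crossed_nature h'
  end.

Definition arises t (w : seq A) : Prop :=
  exists2 z, z \in terminals t & crossed z.1 = w.

Definition crosses_at_most_once t : Prop :=
  forall z, z \in terminals t -> uniq (crossed z.1) /\ uniq (crossed_nature z.1).

Definition kuhn_tree t : Prop :=
  [/\ forall I, (0 < #|M I|)%N, forall J, (0 < #|C J|)%N
    & crosses_at_most_once t].

Definition state : finType := {dffun forall J : B, C J}.

Definition strategy : Type := forall I : A, M I.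

(* Path induced by (s, psi), with the payoff at its end. *)
Fixpoint play (s : strategy) (psi : state) t : history * R :=
  match t with
  | Terminal u => ([::], u)
  | Decision i next =>
      let z := play s psi (next (s i)) in (dstep (s i) :: z.1, z.2)
  | Chance J next =>
      let z := play s psi (next (psi J)) in (cstep (psi J) :: z.1, z.2)
  end.

Definition payoff t (P : state -> R) (s : strategy) : R :=
  \sum_psi P psi * (play s psi t).2.

Definition allowed t (s : strategy) (n : history) : Prop :=
  exists psi : state, prefix n (play s psi t).1.

Definition perfect_recall t : Prop :=
  forall (s : strategy) I (n n' : history),
    n \in nodes_in I t -> n' \in nodes_in I t ->
    (allowed t s n <-> allowed t s n').

Section Signals.
Variable Omega : A -> finType.

(* Omega_{I_1} x ... x Omega_{I_K}, as a nested product. *)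
Fixpoint signals (w : seq A) : finType :=
  match w with
  | [::] => unit
  | i :: w' => (Omega i * signals w')%type
  end.

(* Pr_{I_1...I_K}; the values at sequences that do not arise are irrelevant. *)
Definition signal_law := forall w : seq A, signals w -> R.

Definition signal_structure t (Pr : signal_law) : Prop :=
  forall w, arises t w -> is_prob (Pr w).

Definition profile : Type := forall I : A, Omega I -> M I.

Fixpoint follows (f : profile) (h : history) : signals (crossed h) -> bool :=
  match h return signals (crossed h) -> bool with
  | [::] => fun _ => true
  | inl x :: h' => fun om =>
      (f (tag x) om.1 == tagged x) && follows f (h := h') om.2
  | inr _ :: h' => fun om => follows f (h := h') om
  end.

Definition nature_agrees (h : history) (psi : state) : bool :=
  all (fun st => if st is inr y then psi (tag y) == tagged y else true) h.

Definition signal_payoff t (P : state -> R) (Pr : signal_law) (f : profile) : R :=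
  \sum_(z <- terminals t)
    (\sum_(psi | nature_agrees z.1 psi) P psi) *
    (\sum_(om | follows f (h := z.1) om) Pr (crossed z.1) om) * z.2.

(* There are finitely many strategies and profiles, and at least one of each
   when the sets M I are nonempty, so these suprema are maxima. *)
Definition best_payoff t (P : state -> R) : R :=
  sup (range (payoff t P)).

Definition best_signal_payoff t (P : state -> R) (Pr : signal_law) : R :=
  sup (range (signal_payoff t P Pr)).

Fixpoint restriction (x : {dffun forall I : A, Omega I}) (w : seq A) :
    signals w :=
  match w return signals w with
  | [::] => tt
  | i :: w' => (x i, restriction x w')
  end.

(* One classical signal per information set. *)
Definition classical_sets t (Pr : signal_law) : Prop :=
  exists mu : {dffun forall I : A, Omega I} -> R,
    is_prob mu /\
    forall w, arises t w -> forall om : signals w,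
      Pr w om = \sum_(x | restriction x w == om) mu x.

Definition node t I : finType := seq_sub (nodes_in I t).

(* A value of the signal at every decision node: [x I n] is the signal at the
   node [n] of [I]. *)
Definition node_signals t : finType :=
  {dffun forall I : A, {ffun node t I -> Omega I}}.

(* [om] is the list of signals met by following the branches [h] from the
   node [n0]. *)
Fixpoint observed t (x : node_signals t) (n0 h : history) :
    signals (crossed h) -> bool :=
  match h return signals (crossed h) -> bool with
  | [::] => fun _ => true
  | inl y :: h' => fun om =>
      [exists n : node t (tag y), (val n == n0) && (x (tag y) n == om.1)]
      && observed x (rcons n0 (inl y)) (h := h') om.2
  | inr y :: h' => fun om => observed x (rcons n0 (inr y)) (h := h') om
  end.

Definition perfectly_correlated t (nu : node_signals t -> R) : Prop :=
  forall x, nu x != 0 -> forall I (n n' : node t I), x I n = x I n'.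

Definition permute t (s : forall I, {perm node t I}) (x : node_signals t) :
    node_signals t :=
  [ffun I => [ffun n => x I (s I n)]].

(* Exchangeability concerns the joint law of the signals at all the decision
   nodes: permuting nodes inside the information sets leaves this law
   unchanged. *)
Definition exchangeable t (nu : node_signals t -> R) : Prop :=
  forall (s : forall I, {perm node t I}) x, nu (permute s x) = nu x.

(* The signals at the nodes of each [I] are independent with a common law [q].
   As this alone leaves the dependence between information sets arbitrary
   (it could differ from node to node, and so reveal Nature's moves), the i.i.d.
   case is taken as a special case of exchangeability. *)
Definition iid t (nu : node_signals t -> R) : Prop :=
  (forall I, exists q : Omega I -> R,
     is_prob q /\
     forall y : {ffun node t I -> Omega I},
       \sum_(x : node_signals t | x I == y) nu x = \prod_n q (y n)) /\
  exchangeable nu.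

(* A distinct classical signal at each decision node; [nu] is the joint law. *)
Definition classical_nodes t (Pr : signal_law) : Prop :=
  exists nu : node_signals t -> R,
    [/\ is_prob nu,
        [\/ perfectly_correlated nu, iid nu | exchangeable nu]
      & forall z, z \in terminals t -> forall om : signals (crossed z.1),
          Pr (crossed z.1) om
          = \sum_(x | observed x [::] (h := z.1) om) nu x].

Definition classical t (Pr : signal_law) : Prop :=
  classical_sets t Pr \/ classical_nodes t Pr.

End Signals.
End Tree.

Section Quantum.
Variables (R : realType) (H : lmodType R[i]) (dot : {dot H for Num.conj}).

Definition bounded_operator (a : H -> H) : Prop :=
  linear a /\ exists k : R[i], forall v, dot (a v) (a v) <= k * dot v v.

Definition positive_operator (a : H -> H) : Prop := forall v, 0 <= dot (a v) v.

(* A state, given by its expectation values: a |-> <v | a v> for a unit vector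
   v, a |-> tr (rho a) for a density operator rho. *)
Definition quantum_state (phi : (H -> H) -> R[i]) : Prop :=
  [/\ forall (k : R[i]) a b, bounded_operator a -> bounded_operator b ->
        phi (fun v => k *: a v + b v) = k * phi a + phi b,
      forall a, bounded_operator a -> positive_operator a -> 0 <= phi a
    & phi idfun = 1].

(* A measurement with outcomes in T (a POVM). *)
Definition measurement (T : finType) (E : T -> H -> H) : Prop :=
  (forall om, bounded_operator (E om) /\ positive_operator (E om)) /\
  forall v, \sum_om E om v = v.

Definition compatible (T T' : finType) (E : T -> H -> H) (E' : T' -> H -> H) :=
  forall om om' v, E om (E' om' v) = E' om' (E om v).

Variables (A : finType) (Omega : A -> finType).

Fixpoint joint_operator (E : forall I, Omega I -> H -> H) (w : seq A) :
    signals Omega w -> H -> H :=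
  match w return signals Omega w -> H -> H with
  | [::] => fun _ => idfun
  | i :: w' => fun om => E i om.1 \o joint_operator E (w := w') om.2
  end.

End Quantum.

(* H ranges over complex inner product spaces of any dimension; completeness is
   not required, so that every Hilbert space is included. Measurements made at
   different information sets of one path (e.g. on different particles) are
   compatible; those at information sets never met together need not be. The
   probability of joint outcomes is given by the Born rule. *)
Definition quantum (R : realType) (A B : finType)
    (M : A -> finType) (C : B -> finType) (Omega : A -> finType)
    (t : tree R M C) (Pr : signal_law R Omega) : Prop :=
  exists (H : lmodType R[i]) (dot : {dot H for Num.conj})
         (phi : (H -> H) -> R[i]) (E : forall I, Omega I -> H -> H),
    [/\ quantum_state dot phi,
        forall I, measurement dot (E I),
        forall w, arises t w -> forall I I', I \in w -> I' \in w -> I != I' ->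
          compatible (E I) (E I')
      & forall w, arises t w -> forall om : signals Omega w,
          (Pr w om)%:C%C = phi (joint_operator E om)].

(* Main.v *)
(* Fix a profile [f], and let [W h] be the probability that the signals make the
   team follow the history [h]. In each model of signals [W] extends to all
   nodes of the tree, is additive at decision nodes, and depends only on the set
   of moves made along [h]: by commutativity of the measurements for quantum
   signals, by exchanging the signals of two nodes of the same information set
   for exchangeable ones. By perfect recall the moves made before a node depend
   only on its information set [I], so the conditional probability
   [W (h, m) / W h] of the move [m] is the same at every node [h] of [I]: it
   defines a behaviour strategy, hence a mixture of pure strategies, with the
   same terminal probabilities as the signals. The payoff of [f] is therefore an
   average of payoffs of pure strategies. *)

From HB Require Import structures.
Require Import Defs.
From mathcomp Require Import all_boot all_order all_algebra fingroup perm.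
From mathcomp Require Import all_classical all_reals.

Set Implicit Arguments.
Unset Strict Implicit.
Unset Printing Implicit Defensive.

Import Order.TTheory GRing.Theory Num.Theory.
Local Open Scope ring_scope.

(** * Paths and payoffs *)

Section Paths.
Variables (R : realType) (A B : finType) (M : A -> finType) (C : B -> finType).
Implicit Types (t : tree R M C) (h : history M C).

(** Keeps the subtree hanging below each node and grows histories at the end, so that inductions
    follow play from the root; [terminals] and [nodes_in] build histories from the front. *)
Inductive reaches t : history M C -> tree R M C -> Prop :=
| ReachRoot : reaches t [::] t
| ReachDecision h I next (m : M I) :
    reaches t h (Decision next) -> reaches t (rcons h (dstep C m)) (next m)
| ReachChance h J next (c : C J) :
    reaches t h (Chance next) -> reaches t (rcons h (cstep M c)) (next c).

Lemma reaches_trans t h t' h' t'' :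
  reaches t h t' -> reaches t' h' t'' -> reaches t (h ++ h') t''.
Proof.
move=> tht'; elim=> [|{}h' I next m _ IH|{}h' J next c _ IH].
- by rewrite cats0.
- by rewrite -rcons_cat; apply: ReachDecision.
- by rewrite -rcons_cat; apply: ReachChance.
Qed.

Lemma reaches_terminals t h u :
  reaches t h (Terminal M C u) <-> (h, u) \in terminals t.
Proof.
split=> [|]; last first.
  elim: t h u => [u'|I next IH|J next IH] h u /=.
  - by rewrite inE => /eqP[-> ->]; apply: ReachRoot.
  - move=> /flatten_mapP[m _ /mapP[[h' u'] /IH htu /= [-> ->]]].
    apply: (@reaches_trans _ [:: dstep C m]) htu.
    by apply: (@ReachDecision _ [::]); apply: ReachRoot.
  - move=> /flatten_mapP[c _ /mapP[[h' u'] /IH htu /= [-> ->]]].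
    apply: (@reaches_trans _ [:: cstep M c]) htu.
    by apply: (@ReachChance _ [::]); apply: ReachRoot.
(* The induction on [reaches] needs every terminal node below [t']; the goal is the case where [t']
   is terminal. *)
have aux t' : reaches t h t' -> forall z, z \in terminals t' ->
    (h ++ z.1, z.2) \in terminals t.
  elim=> [|{}h I next m _ IH|{}h J next c _ IH] [h' u'] zt' //=.
  - rewrite cat_rcons; apply: (IH (_ :: h', u')) => /=.
    apply/flatten_mapP; exists m; rewrite ?mem_enum //.
    by apply/mapP; exists (h', u').
  - rewrite cat_rcons; apply: (IH (_ :: h', u')) => /=.
    apply/flatten_mapP; exists c; rewrite ?mem_enum //.
    by apply/mapP; exists (h', u').
by move=> /aux/(_ ([::], u)) /=; rewrite cats0 inE eqxx => /(_ isT).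
Qed.

Lemma reaches_nodes_in t h I :
  (exists next : M I -> tree R M C, reaches t h (Decision next))
  <-> h \in nodes_in I t.
Proof.
split=> [|]; last first.
  elim: t h => [u'|I' next IH|J next IH] h //=.
  - rewrite mem_cat => /orP[|].
      case: eqP => [E|//]; rewrite inE => /eqP->.
      by case: _ / E; exists next; apply: ReachRoot.
    move=> /flatten_mapP[m _ /mapP[h' /IH[next' htu] /= ->]].
    exists next'; apply: (@reaches_trans _ [:: dstep C m]) htu.
    by apply: (@ReachDecision _ [::]); apply: ReachRoot.
  - move=> /flatten_mapP[c _ /mapP[h' /IH[next' htu] /= ->]].
    exists next'; apply: (@reaches_trans _ [:: cstep M c]) htu.
    by apply: (@ReachChance _ [::]); apply: ReachRoot.
have aux t' : reaches t h t' -> forall n, n \in nodes_in I t' ->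
    h ++ n \in nodes_in I t.
  elim=> [|{}h I' next m _ IH|{}h J next c _ IH] n nt' //=.
  - rewrite cat_rcons; apply: IH => /=; rewrite mem_cat; apply/orP; right.
    by apply/flatten_mapP; exists m; rewrite ?mem_enum //; apply/mapP; exists n.
  - rewrite cat_rcons; apply: IH => /=.
    by apply/flatten_mapP; exists c; rewrite ?mem_enum //; apply/mapP; exists n.
move=> [next /aux/(_ [::])]; rewrite cats0; apply.
by rewrite /= eqxx.
Qed.

(** Play can always continue, since all move sets are non-empty. This transfers
    [crosses_at_most_once], a condition on terminal histories, to every node. *)
Lemma reaches_to_terminal t h t' :
    (forall I, (0 < #|M I|)%N) -> (forall J, (0 < #|C J|)%N) ->
  reaches t h t' -> exists2 z, z \in terminals t & prefix h z.1.
Proof.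
move=> M_gt0 C_gt0; elim: t' h => [u|I next IH|J next IH] h tht'.
- by exists (h, u); [apply/reaches_terminals | apply: prefix_refl].
- have /card_gt0P[m _] := M_gt0 I.
  have [z zt hz] := IH m _ (ReachDecision m tht').
  by exists z => //; apply: prefix_trans hz; apply: prefix_rcons.
- have /card_gt0P[c _] := C_gt0 J.
  have [z zt hz] := IH c _ (ReachChance c tht').
  by exists z => //; apply: prefix_trans hz; apply: prefix_rcons.
Qed.

Definition decision_steps h : seq {I : A & M I} :=
  pmap (fun e : step M C => if e is inl y then Some y else None) h.

Definition nature_steps h : seq {J : B & C J} :=
  pmap (fun e : step M C => if e is inr y then Some y else None) h.

(* A single-move information set may be crossed on the way to one node of [I] and
   not to another, as perfect recall does not see it: such steps are dropped. *)
Definition nontrivial_steps h : seq {I : A & M I} :=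
  [seq y <- decision_steps h | (1 < #|M (tag y)|)%N].

Definition strategy_agrees h (s : strategy M) : bool :=
  all (fun e : step M C => if e is inl y then s (tag y) == tagged y else true) h.

Lemma crossedE h : crossed h = map tag (decision_steps h).
Proof. by elim: h => //= -[y|y] h /= ->. Qed.

Lemma crossed_natureE h : crossed_nature h = map tag (nature_steps h).
Proof. by elim: h => //= -[y|y] h /= ->. Qed.

Lemma mem_decision_steps h y : (y \in decision_steps h) = (inl y \in h).
Proof. by elim: h => //= -[y'|y'] h /= IH; rewrite !inE IH. Qed.

Lemma decision_steps_cat h h' :
  decision_steps (h ++ h') = decision_steps h ++ decision_steps h'.
Proof. exact: pmap_cat. Qed.

Lemma decision_steps_dstep h I (m : M I) :
  decision_steps (rcons h (dstep C m))
  = rcons (decision_steps h) (Tagged (fun I => M I) m).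
Proof. by rewrite -!cats1 decision_steps_cat. Qed.

Lemma decision_steps_cstep h J (c : C J) :
  decision_steps (rcons h (cstep M c)) = decision_steps h.
Proof. by rewrite -!cats1 decision_steps_cat cats0. Qed.

Lemma crossed_cat h h' : crossed (h ++ h') = crossed h ++ crossed h'.
Proof. by rewrite !crossedE decision_steps_cat map_cat. Qed.

Lemma strategy_agreesE h s :
  strategy_agrees h s = all (fun y => s (tag y) == tagged y) (decision_steps h).
Proof. by elim: h => //= -[y|y] h /= ->. Qed.

Lemma nature_agreesE h (psi : state C) :
  nature_agrees h psi = all (fun y => psi (tag y) == tagged y) (nature_steps h).
Proof. by elim: h => //= -[y|y] h /= ->. Qed.

Lemma play_agrees s psi t :
  strategy_agrees (play s psi t).1 s && nature_agrees (play s psi t).1 psi.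
Proof. by elim: t => //= [I next IH|J next IH]; rewrite eqxx /=; apply: IH. Qed.

Lemma agrees_play s psi t h t' :
    reaches t h t' -> strategy_agrees h s -> nature_agrees h psi ->
  play s psi t = (h ++ (play s psi t').1, (play s psi t').2).
Proof.
elim=> [|{}h I next m _ IH|{}h J next c _ IH]; first by case: play.
- rewrite /strategy_agrees /nature_agrees !all_rcons /=.
  move=> /andP[/eqP<- hs] hpsi.
  by rewrite (IH hs hpsi) /= cat_rcons.
- rewrite /strategy_agrees /nature_agrees !all_rcons /=.
  move=> hs /andP[/eqP<- hpsi].
  by rewrite (IH hs hpsi) /= cat_rcons.
Qed.

Lemma allowed_agrees t s h : allowed t s h -> strategy_agrees h s.
Proof.
move=> [psi /prefixP[h' E]]; have := play_agrees s psi t.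
by rewrite E /strategy_agrees all_cat -andbA => /andP[].
Qed.

Lemma agrees_allowed t s h t' psi :
  reaches t h t' -> strategy_agrees h s -> nature_agrees h psi -> allowed t s h.
Proof.
move=> tht' hs hpsi; exists psi.
by rewrite (agrees_play tht' hs hpsi) prefix_prefix.
Qed.

(** Exactly one terminal history agrees with both [s] and [psi], so a single term of the sum
    survives. *)
Lemma play_payoffE s psi t :
  (play s psi t).2 =
  \sum_(z <- terminals t)
     (strategy_agrees z.1 s)%:R * (nature_agrees z.1 psi)%:R * z.2.
Proof.
elim: t => [u|I next IH|J next IH] /=.
- by rewrite big_seq1 !mul1r.
- rewrite IH big_flatten big_map big_enum /= (bigD1 (s I)) //= big_map /=.
  rewrite [X in _ + X]big1 ?addr0.
    by apply: eq_bigr => z _; rewrite /= eqxx.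
  move=> m mNs; rewrite big_map big1 // => z _ /=.
  by rewrite eq_sym (negbTE mNs) !mul0r.
- rewrite IH big_flatten big_map big_enum /= (bigD1 (psi J)) //= big_map /=.
  rewrite [X in _ + X]big1 ?addr0.
    by apply: eq_bigr => z _; rewrite /= eqxx.
  move=> c cNpsi; rewrite big_map big1 // => z _ /=.
  by rewrite eq_sym (negbTE cNpsi) mulr0 mul0r.
Qed.

(** Separates Nature from the team, as in [signal_payoff]: only the middle factor, here an
    indicator, differs. *)
Lemma payoffE t (P : state C -> R) s :
  payoff t P s =
  \sum_(z <- terminals t)
     (\sum_(psi | nature_agrees z.1 psi) P psi) * (strategy_agrees z.1 s)%:R * z.2.
Proof.
rewrite /payoff; under eq_bigr do rewrite play_payoffE mulr_sumr.
rewrite exchange_big /=; apply: eq_bigr => z _.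
rewrite [X in X * _ * _]big_mkcond !mulr_suml; apply: eq_bigr => psi _.
case: (nature_agrees _ _); last by rewrite mulr0 !mul0r mulr0.
by rewrite mulr1 !mulrA.
Qed.

End Paths.

Lemma uniq_tag_inj (K : eqType) (F : K -> eqType) (l : seq {k : K & F k}) y y' :
  uniq (map tag l) -> y \in l -> y' \in l -> tag y = tag y' -> y = y'.
Proof.
elim: l => //= x l IH /andP[xNl l_uniq]; rewrite !inE.
move=> /predU1P[->|yl] /predU1P[->|y'l] // E; last exact: IH.
- by case/negP: xNl; rewrite E map_f.
- by case/negP: xNl; rewrite -E map_f.
Qed.

(** A list with distinct tags is the graph of a partial choice function, completed arbitrarily
    elsewhere. It supplies states and strategies that agree with a given history. *)
Lemma extend_partial_choice (K : finType) (F : K -> finType)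
    (l : seq {k : K & F k}) :
    (forall k, (0 < #|F k|)%N) -> uniq (map tag l) ->
  exists g : {dffun forall k, F k}, all (fun y => g (tag y) == tagged y) l.
Proof.
move=> F_gt0 l_uniq.
have ex k : exists x : F k,
    forall y, y \in l -> tag y = k -> y == Tagged (fun k => F k) x.
  have [/mapP[y yl ->]|kNl] := boolP (k \in map tag l).
    exists (tagged y) => y' y'l E.
    by rewrite (uniq_tag_inj l_uniq y'l yl E); case: (y).
  have /card_gt0P[x _] := F_gt0 k; exists x => y yl E.
  by case/negP: kNl; rewrite -E map_f.
exists [ffun k => sval (cid (ex k))]; apply/allP => y yl.
by rewrite ffunE; case: cid => x /= /(_ y yl erefl); rewrite eq_Tagged eq_sym.
Qed.

(** * Perfect recall *)

Section Recall.
Variables (R : realType) (A B : finType) (M : A -> finType) (C : B -> finType).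
Variable t : tree R M C.
Hypothesis t_kuhn : kuhn_tree t.
Implicit Types h : history M C.

Lemma reaches_uniq h t' :
  reaches t h t' -> uniq (crossed h) /\ uniq (crossed_nature h).
Proof.
have [M_gt0 C_gt0 t_once] := t_kuhn.
move=> /(reaches_to_terminal M_gt0 C_gt0)[z /t_once[z1 z2] /prefixP[q E]].
move: z1 z2; rewrite E crossed_cat !crossed_natureE /nature_steps pmap_cat map_cat.
by rewrite !cat_uniq => /andP[-> _] /andP[-> _].
Qed.

Lemma uniq_nontrivial_steps h : uniq (crossed h) -> uniq (nontrivial_steps h).
Proof. by rewrite crossedE => /map_uniq; apply: filter_uniq. Qed.

(** A strategy agreeing with [h'] allows [h'], hence by recall allows [h], hence makes the move of
    [y]. If [h'] crosses [tag y], its move there must be that of [y]; otherwise a strategy could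
    agree with [h'] and still move differently at [tag y]. *)
Lemma recall_nontrivial_steps I h h' next next' :
    perfect_recall t ->
    reaches t h (@Decision _ _ _ _ _ I next) ->
    reaches t h' (@Decision _ _ _ _ _ I next') ->
  {subset nontrivial_steps h <= nontrivial_steps h'}.
Proof.
have [M_gt0 C_gt0 _] := t_kuhn.
move=> recall th th' y; rewrite !mem_filter => /andP[y_nt yh]; rewrite y_nt /=.
have [h'u h'n] := reaches_uniq th'.
rewrite crossed_natureE in h'n; rewrite crossedE in h'u.
have [psi psih'] := extend_partial_choice C_gt0 h'n.
have hI : h \in nodes_in I t by apply/reaches_nodes_in; exists next.
have h'I : h' \in nodes_in I t by apply/reaches_nodes_in; exists next'.
have forced (s : {dffun forall I, M I}) :
    all (fun y => s (tag y) == tagged y) (decision_steps h') ->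
    s (tag y) = tagged y.
  move=> sh'.
  have s_h' : allowed t s h'.
    by apply: (agrees_allowed (psi := psi) th');
      rewrite ?strategy_agreesE ?nature_agreesE.
  have := allowed_agrees ((recall s I h h' hI h'I).2 s_h').
  by rewrite strategy_agreesE => /allP/(_ y yh)/eqP.
have [/mapP[y' y'h' E]|yNh'] := boolP (tag y \in map tag (decision_steps h')).
  have [s sh'] := extend_partial_choice M_gt0 h'u.
  suff -> : y = y' by [].
  move: (forced s sh') (allP sh' y' y'h') E => {forced yh y'h' y_nt}.
  by case: y y' => i m [j m'] /= <- /eqP <- E; case: _ / E.
have /card_gt1P[m [m' [_ _ mNm']]] := y_nt.
pose m0 := if m == tagged y then m' else m.
have m0N : m0 != tagged y.
  by rewrite /m0; case: (eqVneq m (tagged y)) => [<-|//]; rewrite eq_sym.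
(* The deviating move [m0] can be prescribed together with the moves of [h'], since [h'] does not
   cross [tag y]. *)
have [|s /= /andP[/eqP/= sm0 sh']] :=
  extend_partial_choice (l := Tagged (fun I => M I) m0 :: decision_steps h') M_gt0.
  by rewrite /= yNh'.
by move: m0N; rewrite -sm0 (forced s sh') eqxx.
Qed.

Lemma perfect_recall_perm_eq I h h' next next' :
    perfect_recall t ->
    reaches t h (@Decision _ _ _ _ _ I next) ->
    reaches t h' (@Decision _ _ _ _ _ I next') ->
  perm_eq (nontrivial_steps h) (nontrivial_steps h').
Proof.
move=> recall th th'; apply: uniq_perm.
- exact: uniq_nontrivial_steps (reaches_uniq th).1.
- exact: uniq_nontrivial_steps (reaches_uniq th').1.
- move=> y; apply/idP/idP; first exact: recall_nontrivial_steps recall th th' y.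
  exact: recall_nontrivial_steps recall th' th y.
Qed.

End Recall.

(** * Behaviour strategies *)

(** Distributivity for dependent families, obtained from the non-dependent one over tagged elements
    by transport along [dffun_of_fprod]. *)
Lemma sum_prod_dffun (R : comPzRingType) (I : finType) (T : I -> finType)
    (F : forall i, T i -> R) :
  \sum_(g : {dffun forall i, T i}) \prod_i F i (g i) = \prod_i \sum_x F i x.
Proof.
pose P i := [ffun x => F i x].
transitivity (\sum_(g : fprod T) \prod_i P i (g i)).
  rewrite (reindex (@dffun_of_fprod I T)); last exact/onW_bij/dffun_of_fprod_bij.
  by apply: eq_bigr => g _; apply: eq_bigr => i _; rewrite !ffunE.
rewrite big_fprod; apply: esym; have := bigA_distr_big_dep (R := R).
move=> /(_ 0 1 *%R +%R I _ (tagged_with T) (fun i => untag 0 (P i))) <-.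
apply: eq_bigr => i _; rewrite -(big_tag P).
by apply: eq_bigr => x _; rewrite ffunE.
Qed.

Section Behaviour.
Variables (R : realType) (A B : finType) (M : A -> finType) (C : B -> finType).
Variable b : forall I : A, M I -> R.
Hypothesis b_sum1 : forall I : A, \sum_(m : M I) b m = 1.
Implicit Types h : history M C.

(** Draw the moves of a pure strategy independently, with weights [b]. As [h] crosses each
    information set at most once, the weight of agreeing with [h] factors along its steps. *)
Lemma sum_strategies_agree h : uniq (crossed h) ->
  \sum_(g : {dffun forall I, M I})
     (\prod_I b (g I)) * (strategy_agrees h g)%:R
  = \prod_(y <- decision_steps h) b (tagged y).
Proof.
rewrite crossedE => hu.
(* Localizes agreement with [h] at [I], so that the indicator becomes a product over all [I]; where
   [h] does not cross [I] it is vacuous and the factor sums to 1. *)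
pose ok I (m : M I) :=
  all (fun y => (tag y == I) ==> (y == Tagged (fun I => M I) m))
    (decision_steps h).
transitivity (
  \sum_(g : {dffun forall I, M I}) \prod_I (b (g I) * (ok I (g I))%:R)).
  apply: eq_bigr => g _; rewrite big_split /=; congr (_ * _).
  rewrite strategy_agreesE; have [hg|] := boolP (all _ _).
    rewrite big1 // => I _; rewrite (_ : ok _ _) //; apply/allP => y yh.
    apply/implyP => /eqP<-; have /eqP-> := allP hg y yh.
    by case: (y).
  move=> /allPn[y yh ygN]; rewrite (bigD1 (tag y)) //=.
  rewrite (_ : ok _ _ = false) ?mul0r //; apply/negP => /allP/(_ y yh).
  by rewrite eqxx eq_Tagged eq_sym (negbTE ygN).
rewrite (sum_prod_dffun (fun I m => b m * (ok I m)%:R)).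
rewrite (bigID (mem (map tag (decision_steps h)))) /=.
rewrite [X in _ * X]big1 ?mulr1; last first.
  move=> I INh; rewrite -[RHS](b_sum1 I); apply: eq_bigr => m _.
  rewrite (_ : ok I m) ?mulr1 //; apply/allP => y yh; apply/implyP => /eqP E.
  by case/negP: INh; rewrite -E map_f.
rewrite -big_uniq //= big_map; apply: eq_big_seq => y yh.
rewrite (bigD1 (tagged y)) //= big1 ?addr0.
  rewrite (_ : ok _ _) ?mulr1 //; apply/allP => y' y'h; apply/implyP => /eqP E.
  by rewrite (uniq_tag_inj hu y'h yh E); case: (y).
move=> m mNy; suff -> : ok _ m = false by rewrite mulr0.
apply/negP => /allP/(_ y yh); rewrite eqxx /= eq_Tagged eq_sym => E.
by rewrite E in mNy.
Qed.

End Behaviour.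

(** * Realizing a weight on histories by a mixture of pure strategies *)

Section Realization.
Variables (R : realType) (A B : finType) (M : A -> finType) (C : B -> finType).
Variables (t : tree R M C) (P : state C -> R).
Hypothesis t_kuhn : kuhn_tree t.
Implicit Types h : history M C.

Lemma payoff_le_best (g : {dffun forall I, M I}) : payoff t P g <= best_payoff t P.
Proof.
apply: ub_le_sup; last by exists (fun I => g I).
(* An upper bound must be exhibited for [sup] to be meaningful; the finitely many absolute payoffs
   add up to one. *)
exists (\sum_(g' : {dffun forall I, M I}) `|payoff t P g'|) => _ [s _ <-].
pose g' := [ffun I => s I] : {dffun forall I, M I}.
have -> : s = g' by apply: functional_extensionality_dep => I; rewrite ffunE.
rewrite (bigD1 g') //= (le_trans (ler_norm _)) // lerDl.
exact: sumr_ge0.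
Qed.

(** The interface shared by all signal models. Nonnegativity is required only at terminal nodes,
    where signal laws give it; [realization_ge0] carries it up the tree. *)
Variable W : history M C -> R.
Hypothesis W_root : W [::] = 1.
Hypothesis W_decision : forall h I (next : M I -> tree R M C),
  reaches t h (Decision next) -> W h = \sum_(m : M I) W (rcons h (dstep C m)).
Hypothesis W_chance : forall h J (next : C J -> tree R M C) (c : C J),
  reaches t h (Chance next) -> W (rcons h (cstep M c)) = W h.
Hypothesis W_terminal : forall h u, reaches t h (Terminal M C u) -> 0 <= W h.
Hypothesis W_perm : forall h h' t1 t2, reaches t h t1 -> reaches t h' t2 ->
  perm_eq (nontrivial_steps h) (nontrivial_steps h') -> W h = W h'.

Lemma realization_ge0 h t' : reaches t h t' -> 0 <= W h.
Proof.
have [_ C_gt0 _] := t_kuhn.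
elim: t' h => [u|I next IH|J next IH] h tht'.
- exact: W_terminal tht'.
- rewrite (W_decision tht') sumr_ge0 // => m _.
  exact: IH (ReachDecision m tht').
- have /card_gt0P[c _] := C_gt0 J.
  by rewrite -(W_chance c tht'); apply: IH (ReachChance c tht').
Qed.

Hypothesis t_recall : perfect_recall t.

Lemma realization_perm I h h' next next' (m : M I) :
    reaches t h (@Decision _ _ _ _ _ I next) ->
    reaches t h' (@Decision _ _ _ _ _ I next') ->
  W (rcons h (dstep C m)) = W (rcons h' (dstep C m)).
Proof.
move=> th th'; apply: W_perm (ReachDecision m th) (ReachDecision m th') _.
have := perfect_recall_perm_eq t_kuhn t_recall th th'.
rewrite /nontrivial_steps !decision_steps_dstep !filter_rcons.
by case: ifP => // _; rewrite -!cats1 perm_cat2r.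
Qed.

(** If some node of [I] has nonzero weight, [b] is the conditional weight of the moves there, and
    recall makes it valid at every node of [I]. If none has, nonnegativity makes all continuations
    vanish and any distribution, here a point mass, works. *)
Lemma behaviour_exists I : exists b : M I -> R,
  [/\ forall m, 0 <= b m, \sum_m b m = 1
    & forall h next m, reaches t h (@Decision _ _ _ _ _ I next) ->
        W (rcons h (dstep C m)) = W h * b m].
Proof.
have [M_gt0 _ _] := t_kuhn.
have [[h [next [th Wh]]]|W0] := pselect (exists h next,
    reaches t h (@Decision _ _ _ _ _ I next) /\ W h != 0).
  exists (fun m => W (rcons h (dstep C m)) / W h); split.
  - move=> m; rewrite divr_ge0 ?(realization_ge0 th) //.
    exact: realization_ge0 (ReachDecision m th).
  - by rewrite -mulr_suml -(W_decision th) mulfV.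
  - move=> h' next' m th'.
    (* Both weights are sums over the moves at [I], and the summands agree by [realization_perm]. *)
    have -> : W h' = W h.
      rewrite (W_decision th) (W_decision th'); apply: eq_bigr => m' _.
      exact: realization_perm th' th.
    by rewrite mulrCA mulfV // mulr1; apply: realization_perm th' th.
have /card_gt0P[m0 _] := M_gt0 I.
exists (fun m => (m == m0)%:R); split.
- by move=> m; rewrite ler0n.
- by rewrite (bigD1 m0) //= eqxx big1 ?addr0 // => m /negbTE->.
- move=> h next m th.
  have Wh : W h = 0 by apply/eqP/negP => /negP Wh; apply: W0; exists h, next.
  rewrite Wh mul0r; have := W_decision th; rewrite Wh => /esym/psumr_eq0P.
  apply=> // m' _; exact: realization_ge0 (ReachDecision m' th).
Qed.

(* Kuhn's theorem: a behaviour strategy realizes [W] on the terminal nodes, and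
   it is a mixture of pure strategies. *)
Lemma realization_le_best : is_prob P ->
  \sum_(z <- terminals t)
     (\sum_(psi | nature_agrees z.1 psi) P psi) * W z.1 * z.2 <= best_payoff t P.
Proof.
move=> [P_ge0 P_sum1].
pose b I := sval (cid (behaviour_exists I)).
have bP I := svalP (cid (behaviour_exists I)).
have b_sum1 I : \sum_m b I m = 1 by case: (bP I).
pose mix (g : {dffun forall I, M I}) := \prod_I b I (g I).
have WE h t' : reaches t h t' ->
    W h = \prod_(y <- decision_steps h) b (tag y) (tagged y).
  elim=> [|{}h I next m th IH|{}h J next c th IH].
  - by rewrite big_nil.
  - have [_ _ bW] := bP I.
    by rewrite (bW _ _ m th) IH decision_steps_dstep big_rcons.
  - by rewrite (W_chance _ th) decision_steps_cstep.
(* The product of behaviour probabilities along a path is rewritten as the total weight of the pure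
   strategies that follow it. *)
have {}WE z : z \in terminals t ->
    W z.1 = \sum_g mix g * (strategy_agrees z.1 g)%:R.
  case: z => h u /reaches_terminals th; rewrite (WE _ _ th).
  by rewrite sum_strategies_agree // (reaches_uniq t_kuhn th).1.
have -> : \sum_(z <- terminals t)
     (\sum_(psi | nature_agrees z.1 psi) P psi) * W z.1 * z.2
   = \sum_g mix g * payoff t P g.
  under [RHS]eq_bigr do rewrite payoffE mulr_sumr.
  rewrite exchange_big /=; apply: eq_big_seq => z zt.
  rewrite (WE _ zt) mulr_sumr mulr_suml; apply: eq_bigr => g _.
  by rewrite !mulrA; congr (_ * _ * _); rewrite mulrC.
have mix_sum1 : \sum_g mix g = 1.
  by rewrite sum_prod_dffun big1.
rewrite -[leRHS]mul1r -mix_sum1 mulr_suml ler_sum // => g _.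
rewrite ler_wpM2l ?payoff_le_best //; apply: prodr_ge0 => I _.
by have [b_ge0 _ _] := bP I; apply: b_ge0.
Qed.

End Realization.

(** * Prefixes and linear maps *)

Lemma mem_find_prefix (T : eqType) (a : pred T) (s p : seq T) (x : T) :
  a x -> ~~ has a p -> prefix (rcons p x) s -> p = take (find a s) s.
Proof.
move=> ax aNp /prefixP[q ->]; rewrite cat_rcons find_cat (negbTE aNp) /= ax addn0.
by rewrite take_size_cat.
Qed.

Lemma prefix_rconsE (T : eqType) (p s : seq T) (x : T) :
  prefix p (rcons s x) = (p == rcons s x) || prefix p s.
Proof.
apply/idP/idP => [/prefixP[q]|/predU1P[->|ps]].
- case/lastP: q => [|q z]; first by rewrite cats0 => ->; rewrite eqxx.
  by rewrite -rcons_cat => /rcons_inj[-> _]; rewrite prefix_prefix orbT.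
- exact: prefix_refl.
- exact: prefix_trans ps (prefix_rcons _ _).
Qed.

Lemma linear_fun_sum (R : pzRingType) (U V : lmodType R) (a : U -> V) :
  linear a -> forall (I : Type) (r : seq I) (Q : pred I) (F : I -> U),
  a (\sum_(i <- r | Q i) F i) = \sum_(i <- r | Q i) a (F i).
Proof.
move=> a_lin.
pose a' : {linear U -> V} :=
  HB.pack a (GRing.isLinear.Build _ _ _ _ a a_lin).
exact: (linear_sum a').
Qed.

(** * Operators and states *)

Section Operators.
Variables (R : realType) (H : lmodType R[i]) (dot : {dot H for Num.conj}).
Implicit Types a b : H -> H.

Let bounded := bounded_operator dot.

(** The constant in [bounded_operator] is any complex number, but [k * dot v v] dominates a
    nonnegative number, so it equals its own modulus and [k] may be replaced by its modulus. *)
Lemma bounded_norm a : bounded a ->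
  exists2 k : R[i], 0 <= k & forall v, dot (a v) (a v) <= k * dot v v.
Proof.
move=> [_ [k ak]]; exists `|k| => // v; apply: le_trans (ak v) _.
have kv : 0 <= k * dot v v by apply: le_trans (ak v); apply: dnorm_ge0.
by rewrite -(ger0_norm kv) normrM (ger0_norm (dnorm_ge0 _ _)).
Qed.

Lemma bounded_idfun : bounded idfun.
Proof. by split=> [//|]; exists 1 => v; rewrite mul1r. Qed.

Lemma bounded0 : bounded (fun _ => 0).
Proof.
split; first by move=> k u v; rewrite scaler0 addr0.
by exists 0 => v; rewrite mul0r linear0l.
Qed.

Lemma bounded_comp a b : bounded a -> bounded b -> bounded (a \o b).
Proof.
move=> a_bd b_bd; split.
  by move=> k u v /=; rewrite b_bd.1 a_bd.1.
have [k k_ge0 ak] := bounded_norm a_bd; have [l _ bl] := bounded_norm b_bd.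
exists (k * l) => v /=; apply: le_trans (ak _) _.
by rewrite -mulrA ler_wpM2l.
Qed.

Lemma boundedD a b : bounded a -> bounded b -> bounded (fun v => a v + b v).
Proof.
move=> a_bd b_bd; split.
  by move=> k u v; rewrite b_bd.1 a_bd.1 scalerDr addrACA.
have [k _ ak] := bounded_norm a_bd; have [l _ bl] := bounded_norm b_bd.
exists (2 * (k + l)) => v.
(* parallelogram law *)
have : dot (a v + b v) (a v + b v) <= 2 * (dot (a v) (a v) + dot (b v) (b v)).
  rewrite -subr_ge0 (_ : _ - _ = dot (a v - b v) (a v - b v)) ?dnorm_ge0 //.
  by rewrite dnormB dnormD mulr_natl mulr2n opprD addrA addrK.
move=> /le_trans; apply; rewrite -mulrA ler_wpM2l // mulrDl.
exact: lerD.
Qed.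

Lemma bounded_sum (I : Type) (r : seq I) (Q : pred I) (F : I -> H -> H) :
  (forall i, bounded (F i)) -> bounded (fun v => \sum_(i <- r | Q i) F i v).
Proof.
move=> F_bd; elim: r => [|i r IH].
  rewrite (_ : (fun _ => _) = fun _ => 0); first exact: bounded0.
  by apply: functional_extensionality_dep => v; rewrite big_nil.
rewrite (_ : (fun _ => _) =
  if Q i then fun v => F i v + \sum_(j <- r | Q j) F j v
  else fun v => \sum_(j <- r | Q j) F j v); last first.
  by apply: functional_extensionality_dep => v; rewrite big_cons; case: ifP.
by case: ifP => // _; apply: boundedD.
Qed.

Variable phi : (H -> H) -> R[i].
Hypothesis phi_state : quantum_state dot phi.

Lemma stateD a b : bounded a -> bounded b ->
  phi (fun v => a v + b v) = phi a + phi b.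
Proof.
have [phi_lin _ _] := phi_state => a_bd b_bd.
rewrite -[phi a]mul1r -phi_lin //; congr phi.
by apply: functional_extensionality_dep => v; rewrite scale1r.
Qed.

Lemma state0 : phi (fun _ => 0) = 0.
Proof.
apply: (addrI (phi (fun _ => 0))).
rewrite -(stateD bounded0 bounded0) [RHS]addr0; congr phi.
by apply: functional_extensionality_dep => v; rewrite addr0.
Qed.

Lemma state_sum (I : Type) (r : seq I) (Q : pred I) (F : I -> H -> H) :
  (forall i, bounded (F i)) ->
  phi (fun v => \sum_(i <- r | Q i) F i v) = \sum_(i <- r | Q i) phi (F i).
Proof.
move=> F_bd; elim: r => [|i r IH].
  rewrite big_nil -[RHS]state0; congr phi.
  by apply: functional_extensionality_dep => v; rewrite big_nil.
rewrite big_cons -IH; case: ifP => Qi.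
  rewrite -stateD //; last exact: bounded_sum.
  by congr phi; apply: functional_extensionality_dep => v; rewrite big_cons Qi.
by congr phi; apply: functional_extensionality_dep => v; rewrite big_cons Qi.
Qed.

End Operators.

(** * Products of commuting operators *)

Section OperatorProducts.
Variables (T : eqType) (H : Type) (F : T -> H -> H).

Definition operator_product (s : seq T) : H -> H :=
  foldr (fun y a => F y \o a) idfun s.

Lemma operator_product_rcons s y : operator_product (rcons s y) = operator_product s \o F y.
Proof. by elim: s => //= z s ->. Qed.

Lemma operator_product_filter (a : pred T) s :
  (forall y, y \in s -> ~~ a y -> F y =1 id) ->
  operator_product [seq y <- s | a y] = operator_product s.
Proof.
elim: s => //= y s IH Fid.
have <- : operator_product [seq y <- s | a y] = operator_product s.
  by apply: IH => z zs; apply: Fid; rewrite inE zs orbT.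
case: ifP => //= ay; apply: functional_extensionality_dep => v /=.
by rewrite Fid ?inE ?eqxx ?ay.
Qed.

(** The head of [s] is located inside [s'] and commuted leftwards past the factors before it.
    Commutation is needed only between members of the list, which is all that compatibility along
    one path provides. *)
Lemma operator_product_perm s s' : perm_eq s s' ->
    {in s &, forall y y' v, F y (F y' v) = F y' (F y v)} ->
  operator_product s = operator_product s'.
Proof.
elim: s s' => [|y s IH] s' ss' comm.
  by move: ss'; rewrite perm_sym => /perm_nilP->.
have := perm_mem ss' y; rewrite mem_head => /esym /splitPr ys'.
case: ys' ss' => p1 p2 ss'.
have {}ss' : perm_eq s (p1 ++ p2).
  by rewrite -(perm_cons y) (perm_trans ss') // -cat1s perm_catCA.
have ps : {subset p1 <= s} by move=> z zp; rewrite (perm_mem ss') mem_cat zp.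
rewrite /= (IH _ ss'); last first.
  by move=> z z' zs z's; apply: comm; rewrite inE ?zs ?z's orbT.
elim: p1 ps {ss'} => //= z p1 IHp ps.
rewrite -IHp; last by move=> z' z'p; rewrite ps // inE z'p orbT.
apply: functional_extensionality_dep => v /=; apply: comm; rewrite ?mem_head //.
by rewrite inE ps ?orbT ?mem_head.
Qed.

End OperatorProducts.

Lemma Re_sum (R : realType) (I : Type) (r : seq I) (Q : pred I) (F : I -> R[i]) :
  complex.Re (\sum_(i <- r | Q i) F i) = \sum_(i <- r | Q i) complex.Re (F i).
Proof. by apply: (big_morph (@complex.Re R)) => // -[? ?] [? ?]. Qed.

(** * Signals *)

Section Laws.
Variables (R : realType) (A B : finType) (M : A -> finType) (C : B -> finType).
Variables (Omega : A -> finType) (t : tree R M C) (P : state C -> R).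
Hypothesis t_kuhn : kuhn_tree t.
Hypothesis t_recall : perfect_recall t.
Hypothesis P_prob : is_prob P.
Variables (Pr : signal_law R Omega) (f : profile M Omega).
Hypothesis Pr_law : signal_structure t Pr.
Implicit Types h : history M C.

(** Constrained only at sequences that arise, in particular at terminal histories; each signal model
    has to extend it to the other nodes. *)
Definition follow_prob h : R := \sum_(om | follows f (h := h) om) Pr om.

(** Reduces every signal model to finding an extension [W] of [follow_prob]; its nonnegativity at
    terminal nodes comes from [Pr_law]. *)
Lemma signal_payoff_le_best (W : history M C -> R) :
    W [::] = 1 ->
    (forall h I (next : M I -> tree R M C),
       reaches t h (Decision next) -> W h = \sum_(m : M I) W (rcons h (dstep C m))) ->
    (forall h J (next : C J -> tree R M C) (c : C J),
       reaches t h (Chance next) -> W (rcons h (cstep M c)) = W h) ->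
    (forall h h' t1 t2, reaches t h t1 -> reaches t h' t2 ->
       perm_eq (nontrivial_steps h) (nontrivial_steps h') -> W h = W h') ->
    (forall h u, reaches t h (Terminal M C u) -> W h = follow_prob h) ->
  signal_payoff t P Pr f <= best_payoff t P.
Proof.
move=> W1 Wd Wc Wp Wt.
have W_ge0 h u : reaches t h (Terminal M C u) -> 0 <= W h.
  move=> th; rewrite (Wt _ _ th) sumr_ge0 // => om _.
  have [|Pr_ge0 _] := Pr_law (w := crossed h); last exact: Pr_ge0.
  by exists (h, u) => //; apply/reaches_terminals.
apply: le_trans (realization_le_best t_kuhn W1 Wd Wc W_ge0 Wp t_recall P_prob).
rewrite le_eqVlt; apply/orP; left; apply/eqP; apply: eq_big_seq => -[h u].
by move=> /reaches_terminals th; rewrite (Wt _ _ th).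
Qed.

Lemma strategy_agrees_nontrivial h (s : strategy M) :
  strategy_agrees h s = all (fun y => s (tag y) == tagged y) (nontrivial_steps h).
Proof.
rewrite strategy_agreesE all_filter; apply: eq_all => y /=.
case: ltnP => //= /card_le1_eqP triv.
by rewrite (triv (s (tag y)) (tagged y)) ?eqxx.
Qed.

Lemma follows_restriction (x : {dffun forall I, Omega I}) h :
  follows f (h := h) (restriction x (crossed h))
  = strategy_agrees h (fun I => f (x I)).
Proof. by elim: h => //= -[y|y] h /= ->. Qed.

(** Each value [x] of all the signals turns [f] into a pure strategy, so [W] is an average of
    agreement indicators. *)
Lemma classical_sets_le_best :
  classical_sets t Pr -> signal_payoff t P Pr f <= best_payoff t P.
Proof.
move=> [mu [[mu_ge0 mu_sum1] PrE]].
pose s (x : {dffun forall I, Omega I}) I := f (x I).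
apply: (@signal_payoff_le_best
  (fun h => \sum_x mu x * (strategy_agrees h (s x))%:R)).
- by rewrite -[RHS]mu_sum1; apply: eq_bigr => x _; rewrite mulr1.
- move=> h I next _; rewrite exchange_big /=; apply: eq_bigr => x _.
  rewrite (bigD1 (s x I)) //= /strategy_agrees all_rcons /= eqxx /=.
  rewrite big1 ?addr0 // => m mN.
  by rewrite all_rcons /= eq_sym (negbTE mN) mulr0.
- move=> h J next c _; apply: eq_bigr => x _.
  by rewrite /strategy_agrees all_rcons /=.
- move=> h h' _ _ _ _ hh'; apply: eq_bigr => x _.
  by rewrite !strategy_agrees_nontrivial (perm_all _ hh').
- move=> h u /reaches_terminals th; rewrite /follow_prob.
  have arh : arises t (crossed h) by exists (h, u).
  rewrite [RHS](eq_bigr _ (fun om _ => PrE _ arh om)).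
  (* For fixed [x], only the signal sequence [restriction x (crossed h)] contributes. *)
  rewrite (exchange_big_dep xpredT) //=; apply: eq_bigr => x _.
  rewrite -follows_restriction; case: (boolP (follows _ _)) => [fx|fxN].
    rewrite mulr1 (big_pred1 (restriction x (crossed h))) // => om /=.
    by rewrite eq_sym; case: eqP => [->|_]; rewrite ?fx ?andbF.
  rewrite mulr0 big_pred0 // => om.
  by case: eqP => [<-|_]; rewrite ?andbF // (negbTE fxN).
Qed.

(** * A distinct classical signal at each node *)

Section Nodes.
Implicit Types x : node_signals Omega t.

Fixpoint node_follows x (n0 h : history M C) : bool :=
  match h with
  | [::] => true
  | inl y :: h' =>
      [exists n : node t (tag y), (val n == n0) && (f (x (tag y) n) == tagged y)]
      && node_follows x (rcons n0 (inl y)) h'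
  | inr y :: h' => node_follows x (rcons n0 (inr y)) h'
  end.

Lemma exists_node I (a : pred (node t I)) (n : node t I) n0 :
  val n = n0 -> [exists n' : node t I, (val n' == n0) && a n'] = a n.
Proof.
move=> <-; apply/existsP/idP => [[n' /andP[/eqP/val_inj-> //]]|an].
by exists n; rewrite eqxx.
Qed.

(** The signals [x] determine the sequence observed along [h], so at most one [om] counts. If [h]
    takes a decision step at a history that is not a node of the tree, both sides vanish. *)
Lemma sum_follows_observed x n0 h :
  \sum_om (follows f (h := h) om && observed x n0 (h := h) om)%:R
  = (node_follows x n0 h)%:R :> R.
Proof.
elim: h n0 => [|[y|y] h IH] n0 /=; last exact: IH.
  by rewrite (bigD1 tt) //= big1 ?addr0 // => -[].
pose a o := (f o == tagged y) &&
  [exists n : node t (tag y), (val n == n0) && (x (tag y) n == o)].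
pose b om := follows f (h := h) om && observed x (rcons n0 (inl y)) (h := h) om.
transitivity (\sum_o \sum_om (a o)%:R * (b om)%:R : R).
  rewrite pair_bigA; apply: eq_bigr => -[o om] _ /=.
  by rewrite -natrM mulnb /a /b andbACA.
under eq_bigr do rewrite -mulr_sumr IH.
rewrite -mulr_suml -mulnb natrM; congr (_ * _); rewrite {}/a.
have [n0I|n0NI] := boolP (n0 \in nodes_in (tag y) t); last first.
  have E (a : pred (node t (tag y))) : [exists n, (val n == n0) && a n] = false.
    by apply/existsP => -[n /andP[/eqP E _]]; rewrite -E (valP n) in n0NI.
  by rewrite E big1 // => o _; rewrite E andbF.
have E (a : pred _) := @exists_node _ a (SeqSub n0I) n0 erefl.
rewrite E (bigD1 (x (tag y) (SeqSub n0I))) //= E eqxx andbT big1 ?addr0 // => o oN.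
by rewrite E [_ == o]eq_sym (negbTE oN) andbF.
Qed.

Lemma node_follows_rcons x n0 h e :
  node_follows x n0 (rcons h e) = node_follows x n0 h &&
    (if e is inl y then
       [exists n : node t (tag y),
          (val n == n0 ++ h) && (f (x (tag y) n) == tagged y)]
     else true).
Proof.
elim: h n0 => [|[y|y] h IH] n0 /=.
- by rewrite cats0; case: e => y /=; rewrite ?andbT.
- by rewrite IH cat_rcons andbA.
- by rewrite IH cat_rcons.
Qed.

Lemma node_follows_dstep x h I (m : M I) (hI : h \in nodes_in I t) :
  node_follows x [::] (rcons h (dstep C m))
  = node_follows x [::] h && (f (x I (SeqSub hI)) == m).
Proof. by rewrite node_follows_rcons /= (@exists_node _ _ (SeqSub hI)). Qed.

Lemma node_follows_cstep x h J (c : C J) :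
  node_follows x [::] (rcons h (cstep M c)) = node_follows x [::] h.
Proof. by rewrite node_follows_rcons andbT. Qed.

(** Replaces the recursion along [h] by a separate condition at each decision step, so that
    histories making the same moves in different orders can be compared. *)
Lemma node_followsP x n0 h :
  reflect (forall p y, prefix (rcons p (inl y)) h ->
             exists2 n : node t (tag y), val n = n0 ++ p & f (x (tag y) n) = tagged y)
          (node_follows x n0 h).
Proof.
elim: h n0 => [|[z|z] h IH] n0 /=.
- by constructor => -[].
- apply: (iffP andP) => [[zn0 /IH hh]|hh].
    move=> [|e p] y /=.
      rewrite prefix0s andbT => /eqP[->].
      by case/existsP: zn0 => n /andP[/eqP E /eqP fn]; exists n; rewrite ?cats0.
    by move=> /andP[/eqP-> /hh[n En fn]]; exists n; rewrite // En cat_rcons.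
  split.
    have [|n En fn] := hh [::] z; first by rewrite /= eqxx prefix0s.
    rewrite cats0 in En.
    by apply/existsP; exists n; apply/andP; split; apply/eqP.
  apply/IH => p y py; have [|n En fn] := hh (inl z :: p) y; first by rewrite /= eqxx.
  by exists n; rewrite // ?cat_rcons // -cat_rcons.
- apply: (iffP (IH _)) => hh.
    move=> [|e p] y //= /andP[/eqP-> /hh[n En fn]].
    by exists n; rewrite // ?cat_rcons // -cat_rcons.
  move=> p y py; have [|n En fn] := hh (inr z :: p) y; first by rewrite /= eqxx.
  by exists n; rewrite // ?cat_rcons // -cat_rcons.
Qed.

(** The history at which [h] first crosses [I]; it falls back to [h] itself when there is no
    crossing. *)
Definition crossing_node I h : history M C :=
  take (find (fun e : step M C => if e is inl y then tag y == I else false) h) h.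

(* Exchanges the nodes at which [h] and [h'] cross [I]; only its values at the
   information sets crossed by both histories matter. *)
Definition node_swap h h' I : {perm node t I} :=
  if insub (crossing_node I h) is Some n then
    if insub (crossing_node I h') is Some n' then tperm n n' else 1%g
  else 1%g.

(** Since each history crosses [tag y] at most once, the search in [crossing_node] stops exactly at
    [n] on [h] and at [n'] on [h']. *)
Lemma node_swapE h h' t1 t2 (y : {I : A & M I}) (n n' : node t (tag y)) :
    reaches t h t1 -> reaches t h' t2 ->
    prefix (rcons (val n) (inl y)) h -> prefix (rcons (val n') (inl y)) h' ->
  node_swap h h' (tag y) n = n'.
Proof.
have find_node h0 t0 p : reaches t h0 t0 -> prefix (rcons p (inl y)) h0 ->
    p = crossing_node (tag y) h0.
  move=> th0 ph0; apply: (mem_find_prefix _ _ ph0) => //=.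
  have [+ _] := reaches_uniq t_kuhn th0; case/prefixP: ph0 => q ->.
  rewrite cat_rcons crossed_cat cat_uniq /= negb_or => /and3P[_ /andP[yN _] _].
  apply: contra yN => /hasP[[y'|//] y'p /eqP<-].
  by rewrite crossedE map_f // mem_decision_steps.
move=> th th' nh n'h'; rewrite /node_swap.
rewrite -(find_node h t1 (val n)) //.
by rewrite -(find_node h' t2 (val n')) // !valK tpermL.
Qed.

Lemma reaches_prefix h t' y p :
  reaches t h t' -> prefix (rcons p (inl y)) h -> p \in nodes_in (tag y) t.
Proof.
move=> th; elim: th p => [|{}h I next m th IH|{}h J next c th IH] p.
- by move=> /prefixP[q]; case: p.
- rewrite prefix_rconsE eqseq_rcons => /orP[/andP[/eqP-> /eqP[->]]|/IH//].
  by apply/reaches_nodes_in; exists next.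
- by rewrite prefix_rconsE eqseq_rcons andbF => /IH.
Qed.

Lemma nontrivial_step_prefix h h' y p :
    perm_eq (nontrivial_steps h) (nontrivial_steps h') ->
    prefix (rcons p (inl y)) h -> (1 < #|M (tag y)|)%N ->
  exists p', prefix (rcons p' (inl y)) h'.
Proof.
move=> hh' /prefixP[q E] y_nt.
have : y \in nontrivial_steps h'.
  rewrite -(perm_mem hh') mem_filter y_nt mem_decision_steps E.
  by rewrite mem_cat mem_rcons mem_head.
rewrite mem_filter y_nt mem_decision_steps => /splitPr[p1 p2].
by exists p1; rewrite -cat_rcons prefix_prefix.
Qed.

(** At an information set with several moves, both histories make the same move, and the swap gives
    the node on [h] the signal of the node on [h']. At single-move sets every signal yields the
    required move. *)
Lemma node_follows_permute h h' t1 t2 x :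
    reaches t h t1 -> reaches t h' t2 ->
    perm_eq (nontrivial_steps h) (nontrivial_steps h') ->
  node_follows (permute (node_swap h h') x) [::] h = node_follows x [::] h'.
Proof.
move=> th th' hh'; apply/node_followsP/node_followsP => follow p y py.
  have pI := reaches_prefix th' py; exists (SeqSub pI) => //.
  have [y_le1|y_nt] := leqP #|M (tag y)| 1.
    by move/card_le1_eqP: y_le1; apply.
  have hh'C : perm_eq (nontrivial_steps h') (nontrivial_steps h).
    by rewrite perm_sym.
  have [p' p'y] := nontrivial_step_prefix hh'C py y_nt.
  have [n En] := follow _ _ p'y.
  rewrite !ffunE (node_swapE (n' := SeqSub pI) th th') //.
  by rewrite En.
have pI := reaches_prefix th py; exists (SeqSub pI) => //.
have [y_le1|y_nt] := leqP #|M (tag y)| 1.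
  by move/card_le1_eqP: y_le1; apply.
have [p' p'y] := nontrivial_step_prefix hh' py y_nt.
have [n En fn] := follow _ _ p'y.
by rewrite !ffunE (node_swapE (n' := n) th th') // En.
Qed.

Lemma permuteK (s : forall I, {perm node t I}) :
  cancel (permute s) (permute (Omega := Omega) (fun I => (s I)^-1%g)).
Proof. by move=> x; apply/ffunP=> I; apply/ffunP => n; rewrite !ffunE permKV. Qed.

Lemma permuteKV (s : forall I, {perm node t I}) :
  cancel (permute (fun I => (s I)^-1%g)) (permute (Omega := Omega) s).
Proof. by move=> x; apply/ffunP=> I; apply/ffunP => n; rewrite !ffunE permK. Qed.

(** If either [x] or its permutation has nonzero weight, that one is constant on each information
    set; then so is the other, and the two coincide. *)
Lemma perfectly_correlated_exchangeable (nu : node_signals Omega t -> R) :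
  perfectly_correlated nu -> exchangeable nu.
Proof.
move=> corr s x; have [x0|/corr xc] := eqVneq (nu x) 0; last first.
  congr nu; apply/ffunP => I; apply/ffunP => n.
  by rewrite !ffunE; apply: xc.
have [sx0|/corr xc] := eqVneq (nu (permute s x)) 0; first by rewrite sx0 x0.
congr nu; apply/ffunP => I; apply/ffunP => n; rewrite !ffunE.
have := xc I ((s I)^-1%g n) n; by rewrite !ffunE permKV.
Qed.

Lemma classical_nodes_le_best :
  classical_nodes t Pr -> signal_payoff t P Pr f <= best_payoff t P.
Proof.
move=> [nu [[nu_ge0 nu_sum1] nu_type PrE]].
have nu_exch : exchangeable nu.
  by case: nu_type => [/perfectly_correlated_exchangeable|[]|].
apply: (@signal_payoff_le_best
  (fun h => \sum_x nu x * (node_follows x [::] h)%:R)).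
- by rewrite -[RHS]nu_sum1; apply: eq_bigr => x _; rewrite mulr1.
- move=> h I next th; rewrite exchange_big /=; apply: eq_bigr => x _.
  have hI : h \in nodes_in I t by apply/reaches_nodes_in; exists next.
  under eq_bigr do rewrite (node_follows_dstep _ _ hI).
  rewrite (bigD1 (f (x I (SeqSub hI)))) //= eqxx andbT.
  rewrite big1 ?addr0 // => m mN.
  by rewrite eq_sym (negbTE mN) andbF mulr0.
- move=> h J next c _; apply: eq_bigr => x _.
  by rewrite node_follows_cstep.
- move=> h h' t1 t2 th th' hh'.
  (* The swap preserves [nu] by exchangeability and turns following [h] into following [h']. *)
  rewrite [LHS](reindex (permute (node_swap h h'))); last first.
    exact/onW_bij/(Bijective (permuteK _) (permuteKV _)).
  by apply: eq_bigr => x _; rewrite nu_exch (node_follows_permute _ th th').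
- move=> h u /reaches_terminals th; rewrite /follow_prob.
  rewrite [RHS](eq_bigr _ (fun om _ => PrE (h, u) th om)) /=.
  rewrite (exchange_big_dep xpredT) //=; apply: eq_bigr => x _.
  rewrite -sum_follows_observed mulr_sumr [RHS]big_mkcond /=; apply: eq_bigr => om _.
  by case: ifP; rewrite ?mulr1 ?mulr0.
Qed.

End Nodes.

(** * Quantum signals *)

Section Quantum.
Variables (H : lmodType R[i]) (dot : {dot H for Num.conj}).
Variable E : forall I, Omega I -> H -> H.
Hypothesis E_meas : forall I, measurement dot (E (I := I)).

(* The measurement obtained by reading the outcome at [I] through [f]. *)
Definition move_operator (y : {I : A & M I}) (v : H) : H :=
  \sum_(om | f om == tagged y) E om v.

Lemma bounded_move_operator y : bounded_operator dot (move_operator y).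
Proof. by apply: bounded_sum => om; case: ((E_meas (tag y)).1 om). Qed.

Lemma bounded_operator_product s :
  bounded_operator dot (operator_product move_operator s).
Proof.
elim: s => [|y s IH] /=; first exact: bounded_idfun.
exact: bounded_comp (bounded_move_operator y) IH.
Qed.

Lemma bounded_joint_operator w (om : signals Omega w) :
  bounded_operator dot (joint_operator E om).
Proof.
elim: w om => [|I w IH] om /=; first exact: bounded_idfun.
by apply: bounded_comp (IH om.2); case: ((E_meas I).1 om.1).
Qed.

Lemma sum_move_operator I v :
  \sum_(m : M I) move_operator (Tagged (fun I => M I) m) v = v.
Proof.
rewrite -[RHS](E_meas I).2 (partition_big (f (I := I)) xpredT) //=.
Qed.

Lemma move_operator_trivial y : (#|M (tag y)| <= 1)%N -> move_operator y =1 id.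
Proof.
move=> /card_le1_eqP triv v; rewrite -[RHS](E_meas (tag y)).2.
by apply: eq_bigl => om; rewrite (triv (f om) (tagged y)) ?eqxx.
Qed.

(** By linearity, the product of the coarse-grained measurements expands into the joint operators of
    the outcome sequences that lead along [h]. *)
Lemma operator_product_follows h v :
  operator_product move_operator (decision_steps h) v
  = \sum_(om | follows f (h := h) om) joint_operator E om v.
Proof.
elim: h => [|[y|y] h IH] /=; last exact: IH.
  by rewrite (big_pred1 tt) // => -[].
rewrite IH /move_operator.
under [LHS]eq_bigr => om _ do
  rewrite (linear_fun_sum ((E_meas (tag y)).1 om).1.1).
by rewrite pair_big.
Qed.

Lemma quantum_le_best phi :
    quantum_state dot phi ->
    (forall w, arises t w -> forall I I', I \in w -> I' \in w -> I != I' ->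
       compatible (E (I := I)) (E (I := I'))) ->
    (forall w, arises t w -> forall om : signals Omega w,
       (Pr om)%:C%C = phi (joint_operator E om)) ->
  signal_payoff t P Pr f <= best_payoff t P.
Proof.
move=> phi_state E_comp born.
have [M_gt0 C_gt0 _] := t_kuhn.
pose op h := operator_product move_operator (decision_steps h).
(* The real part makes [W] real-valued at every node; at terminal nodes the Born rule shows that
   nothing is lost. *)
apply: (@signal_payoff_le_best (fun h => complex.Re (phi (op h)))).
- by have [_ _ /= ->] := phi_state.
- move=> h I next _; rewrite -Re_sum; congr complex.Re.
  rewrite -(state_sum phi_state); last first.
    by move=> m; apply: bounded_operator_product.
  congr phi; apply: functional_extensionality_dep => v.
  (* The identity, written as the sum of the move operators at [I], is inserted on the right of the
     product, where the last step of a history acts. *)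
  rewrite -[in LHS](sum_move_operator I v).
  rewrite /op (linear_fun_sum (bounded_operator_product _).1).
  apply: eq_bigr => m _.
  by rewrite decision_steps_dstep operator_product_rcons.
- by move=> h J next c _; rewrite /op decision_steps_cstep.
- move=> h h' t1 t2 th _ hh'; congr (complex.Re (phi _)).
  have trivial s : operator_product move_operator (nontrivial_steps s) = op s.
    apply: operator_product_filter => y _; rewrite -leqNgt.
    exact: move_operator_trivial.
  rewrite -!trivial; apply: operator_product_perm hh' _ => y y' yh y'h v.
  (* Compatibility is assumed along sequences that arise, so [h] is extended to a terminal
     history. *)
  have [z zt /prefixP[q zE]] := reaches_to_terminal M_gt0 C_gt0 th.
  have crossed_z y0 : y0 \in nontrivial_steps h -> tag y0 \in crossed z.1.
    rewrite mem_filter zE crossed_cat mem_cat crossedE => /andP[_ y0h].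
    by rewrite map_f.
  have [->//|yNy'] := eqVneq y y'.
  have tyNty' : tag y != tag y'.
    apply: contra_neq yNy'; apply: uniq_tag_inj yh y'h.
    have [+ _] := reaches_uniq t_kuhn th; rewrite crossedE.
    exact/subseq_uniq/map_subseq/filter_subseq.
  rewrite /move_operator.
  under [LHS]eq_bigr => om _ do
    rewrite (linear_fun_sum ((E_meas (tag y)).1 om).1.1).
  under [RHS]eq_bigr => om _ do
    rewrite (linear_fun_sum ((E_meas (tag y')).1 om).1.1).
  rewrite exchange_big /=; apply: eq_bigr => om' _; apply: eq_bigr => om _.
  have arz : arises t (crossed z.1) by exists z.
  exact: (E_comp _ arz) (crossed_z _ yh) (crossed_z _ y'h) tyNty' _ _ _.
- move=> h u /reaches_terminals th.
  have arh : arises t (crossed h) by exists (h, u).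
  have -> : op h = fun v => \sum_(om | follows f (h := h) om) joint_operator E om v.
    apply: functional_extensionality_dep => v.
    exact: operator_product_follows.
  rewrite (state_sum phi_state); last exact: bounded_joint_operator.
  rewrite Re_sum; apply: eq_bigr => om _.
  by rewrite -(born _ arh om).
Qed.

End Quantum.

End Laws.

Theorem mainTheorem4 (R : realType) (A B : finType)
    (M : A -> finType) (C : B -> finType) (Omega : A -> finType)
    (t : tree R M C) (P : state C -> R) (Pr : signal_law R Omega)
    (t_kuhn : kuhn_tree t)
    (P_prob : is_prob P)
    (t_recall : perfect_recall t)
    (Omega_neq0 : forall I, (0 < #|Omega I|)%N)
    (Pr_law : signal_structure t Pr)
    (Pr_type : classical t Pr \/ quantum t Pr) :
  best_signal_payoff t P Pr <= best_payoff t P.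
Proof.
apply: ge_sup => [|_ [f _ <-]].
  (* Bounding a [sup] from above requires a non-empty range: a profile that ignores its signals is a
     witness. *)
  have [M_gt0 _ _] := t_kuhn.
  have M_el I : exists m : M I, True by have /card_gt0P[m _] := M_gt0 I; exists m.
  by exists (signal_payoff t P Pr (fun I _ => sval (cid (M_el I)))); eexists.
case: Pr_type => [[sets|nodes]|].
- exact: classical_sets_le_best sets.
- exact: classical_nodes_le_best nodes.
- move=> [H [dot [phi [E [phi_state E_meas E_comp born]]]]].
  exact: quantum_le_best E_meas _ phi_state E_comp born.
Qed.
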